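(* Let $p$ be an odd prime, $L=\mathbb F_{p^m}$, $\sigma=p^s$ with $0<s<m$, $K_1=\{x\in L:x^\sigma=x\}$, and consider the presemifield $B(p,m,s,l,n,N)$. If $n^{\sigma-1}=N^2$ and $\sigma^2\ne1$ on $L$ (i.e. $x\mapsto x^{\sigma^2}$ is not the identity on $L$), then the middle nucleus $\mathbb N_m$ of the associated semifield satisfies $1\le\dim_{K_1}\mathbb N_m\le3$.
   Context: A finite presemifield $(F,+,* )$ is a finite abelian group $(F,+)$ with a multiplication satisfying both distributive laws and such that $x*y=0$ implies $x=0$ or $y=0$; a semifield is a presemifield with identity. For an integer $k\ge0$, $L^k=\{x^k:x\in L\}$. $B(p,m,s,l,n,N)$ is defined for $l,n,N\in L^*$ with $-l\notin L^{\sigma-1}$ and $x^{\sigma+1}+(1-1/N)x+(1/n-1)/N\ne0$ for all $x\in L$: it is $F=L^2$ with multiplication $(a,b)*(c,d)=(h(a,b,c,d),\,ad+bc)$, where $$h(a,b,c,d)=ac^{\sigma}-nNbd^{\sigma}+l(a^{\sigma}c-nNb^{\sigma}d)+n\{Nad^{\sigma}-bc^{\sigma}+l(a^{\sigma}d-Nb^{\sigma}c)\}.$$ Associated semifield: put $e=(1,0)$, define $\beta,\gamma\colon F\to F$ by $e*\beta(x)=x$ and $\gamma(x)*e=e*x$, and set $x\circ y=\beta(\gamma(x)*y)$. Then $(F,+,\circ)$ is a semifield isotopic to $(F,+,* )$ with identity $e$. The field $K_1$ is identified with $K_1\times\{0\}\subset F$, which is contained in the center of $(F,+,\circ)$; dimensions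 over $K_1$ are with respect to this. The middle nucleus of a semifield $(F,+,\circ)$ is $\mathbb N_m=\{u:(x\circ u)\circ y=x\circ(u\circ y)\ \forall x,y\in F\}$. *)

(* Defs.v *)
From HB Require Import structures.
From mathcomp Require Import all_boot all_order all_algebra all_field.
From mathcomp Require Import ring.

Set Implicit Arguments.
Unset Strict Implicit.
Unset Printing Implicit Defensive.

Import GRing.Theory.
Local Open Scope ring_scope.

(* The associated semifield of a multiplication [mul] on a finite set, with   *)
(* respect to [e]. The default values are never used when [mul] is the        *)
(* multiplication of a presemifield and [e] is nonzero.                       *)
Section AssociatedSemifield.

Variables (F : finType) (mul : F -> F -> F) (e : F).

Definition assoc_beta (x : F) : F := odflt x [pick y | mul e y == x].
Definition assoc_gamma (x : F) : F := odflt x [pick y | mul y e == mul e x].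
Definition assoc_mul (x y : F) : F := assoc_beta (mul (assoc_gamma x) y).

Lemma assoc_betaP : injective (mul e) -> forall x, mul e (assoc_beta x) = x.
Proof.
move=> inj_e x; rewrite /assoc_beta; case: pickP => [y /eqP //|no_y].
by have /eqP := f_invF inj_e x; rewrite no_y.
Qed.

Lemma assoc_gammaP :
  injective (mul^~ e) -> forall x, mul (assoc_gamma x) e = mul e x.
Proof.
move=> inj_e x; rewrite /assoc_gamma; case: pickP => [y /eqP //|no_y].
by have /eqP := f_invF inj_e (mul e x); rewrite no_y.
Qed.

End AssociatedSemifield.

Definition middle_nucleus (F : finType) (mul : F -> F -> F) : {set F} :=
  [set u | [forall x, forall y, mul (mul x u) y == mul x (mul u y)]].

Section Multiplication.

Variables (L : finFieldType) (sigma : nat) (l n N : L).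

Definition B_mul (x y : L * L) : L * L :=
  let: (a, b) := x in let: (c, d) := y in
  (a * c ^+ sigma - n * N * b * d ^+ sigma
     + l * (a ^+ sigma * c - n * N * b ^+ sigma * d)
     + n * (N * a * d ^+ sigma - b * c ^+ sigma
            + l * (a ^+ sigma * d - N * b ^+ sigma * c)),
   a * d + b * c).

Definition B_smul : L * L -> L * L -> L * L := assoc_mul B_mul (1, 0).

End Multiplication.

Section FiniteModule.

Variables (K : finFieldType) (V : finLmodType K).

Let lin d (v : d.-tuple V) (r : 'rV[K]_d) : V := \sum_i r 0 i *: tnth v i.

Let lin_linear d (v : d.-tuple V) : linear (lin v).
Proof.
move=> k r1 r2; rewrite /lin scaler_sumr -big_split /=.
by apply: eq_bigr => i _; rewrite !mxE scalerDl scalerA.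
Qed.

Let indep d : bool := [exists v : d.-tuple V, injectiveb (lin v)].

Let indep0 : exists d, indep d.
Proof.
exists 0%N; apply/existsP; exists [tuple]; apply/injectiveP => r1 r2 _.
by apply/rowP => -[].
Qed.

Let indep_bound d : indep d -> (d <= #|V|)%N.
Proof.
case/existsP=> v /injectiveP inj_v; have := leq_card _ inj_v.
rewrite card_mx mul1n; apply: leq_trans.
by apply/ltnW/ltn_expl/card_finRing_gt1.
Qed.

Let lin_cons d (v : d.-tuple V) x (r : 'rV[K]_(d.+1)) :
  lin [tuple of x :: v] r
    = r 0 0 *: x + lin v (\row_i r 0 (lift ord0 i)).
Proof.
rewrite /lin big_ord_recl; congr (_ + _).
by apply: eq_bigr => i _; rewrite mxE tnthS.
Qed.

Lemma finLmod_vect : {d & Vector.axiom d V}.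
Proof.
pose d := ex_maxn indep0 indep_bound.
have [/existsP /sigW [v /injectiveP inj_v] max_d] : indep d /\ ~~ indep d.+1.
  rewrite /d; case: ex_maxnP => k ind_k max_k; split=> //.
  by apply/negP => /max_k; rewrite ltnn.
have lin_lin := lin_linear v.
pose HL := GRing.isLinear.Build K _ _ _ (lin v) lin_lin.
pose linv : {linear 'rV[K]_d -> V} := HB.pack (lin v) HL.
have surj x : exists r, lin v r == x.
  apply/existsP; apply: contraNT max_d => /existsPn no_r.
  apply/existsP; exists [tuple of x :: v]; apply/injectiveP => r1 r2.
  rewrite !lin_cons; set u1 := \row_i _; set u2 := \row_i _ => eq12.
  have eq0 : r1 0 0 = r2 0 0.
    apply/eqP; rewrite -subr_eq0; apply/idPn => nz.
    case/negP: (no_r ((r1 0 0 - r2 0 0)^-1 *: (u2 - u1))).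
    rewrite -[lin v]/(linv : _ -> _) linearZ linearB /=.
    have -> : lin v u2 - lin v u1 = (r1 0 0 - r2 0 0) *: x.
      rewrite scalerBl; apply/eqP; rewrite subr_eq addrAC eq_sym subr_eq.
      by rewrite eq12 addrC.
    by rewrite scalerA mulVf // scale1r.
  move: eq12; rewrite eq0 => /addrI /inj_v /rowP eqS.
  apply/rowP => i; case: (unliftP 0 i) => [j ->|->] //.
  by have := eqS j; rewrite !mxE.
pose g x := xchoose (surj x).
have gK : cancel g (lin v) by move=> x; apply/eqP/(xchooseP (surj x)).
have Kg : cancel (lin v) g by move=> r; apply: inj_v; rewrite gK.
exists d; exists g; last by exists (lin v).
by move=> k x y; apply: inj_v; rewrite gK lin_lin !gK.
Qed.

End FiniteModule.

(* The subfield K_1 of L fixed by x |-> x ^ (p ^ s). The characteristic is an *)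
(* argument because closure under addition depends on it.                     *)
Section FixedField.

Variables (L : finFieldType) (p : nat) (chLp : p \in [pchar L]) (s : nat).

Definition fixed_pred of p \in [pchar L] : {pred L} :=
  fun x => x ^+ (p ^ s) == x.

Lemma exprDp (x y : L) : (x + y) ^+ (p ^ s) = x ^+ (p ^ s) + y ^+ (p ^ s).
Proof.
by rewrite exprDn_pchar // pnatX pnatE ?chLp // (pcharf_prime chLp).
Qed.

Let sigma_eq0 : (p ^ s == 0)%N = false.
Proof. by rewrite expn_eq0 gtn_eqF // prime_gt0 // (pcharf_prime chLp). Qed.

Lemma exprNp (x : L) : (- x) ^+ (p ^ s) = - x ^+ (p ^ s).
Proof.
by apply/eqP; rewrite -addr_eq0 -exprDp addNr expr0n sigma_eq0.
Qed.

Fact fixed_divring_closed : divring_closed (fixed_pred chLp).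
Proof.
split=> [|x y|x y]; rewrite !unfold_in ?expr1n // => /eqP xE /eqP yE.
  by rewrite exprDp exprNp xE yE.
by rewrite exprMn exprVn xE yE.
Qed.

HB.instance Definition _ :=
  GRing.isDivringClosed.Build L (fixed_pred chLp) fixed_divring_closed.

Record fixed_field : predArgType :=
  FixedField { fixed_val :> L; fixed_valP : fixed_val \in fixed_pred chLp }.

HB.instance Definition _ := [isSub for fixed_val].
HB.instance Definition _ := [Finite of fixed_field by <:].
HB.instance Definition _ :=
  [SubChoice_isSubIntegralDomain of fixed_field by <:].
HB.instance Definition _ :=
  [SubIntegralDomain_isSubField of fixed_field by <:].

(* F = L^2 as a vector space over K_1. The scalar action is componentwise; by *)
(* [B_smulZl] and [B_smulZr] it is multiplication by K_1 x {0} in the         *)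
(* semifield.                                                                 *)
Definition L2 of p \in [pchar L] & nat : predArgType := (L * L)%type.
Local Notation F := (L2 chLp s).

HB.instance Definition _ := GRing.Zmodule.on F.
HB.instance Definition _ := Finite.on F.

Definition L2_scale (k : fixed_field) (x : F) : F :=
  (fixed_val k * x.1, fixed_val k * x.2).

Fact L2_scaleA k1 k2 x : L2_scale k1 (L2_scale k2 x) = L2_scale (k1 * k2) x.
Proof. by rewrite /L2_scale /= !mulrA. Qed.

Fact L2_scale1 : left_id 1 L2_scale.
Proof. by case=> a b; rewrite /L2_scale !mul1r. Qed.

Fact L2_scaleDr : right_distributive L2_scale +%R.
Proof. by move=> k [a b] [c d]; rewrite /L2_scale !mulrDr. Qed.

Fact L2_scaleDl x : {morph L2_scale^~ x : k1 k2 / k1 + k2}.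
Proof. by move=> k1 k2; rewrite /L2_scale !mulrDl. Qed.

HB.instance Definition _ := GRing.Zmodule_isLmodule.Build fixed_field F
  L2_scaleA L2_scale1 L2_scaleDr L2_scaleDl.

HB.instance Definition _ :=
  Lmodule_hasFinDim.Build fixed_field F (projT2 (finLmod_vect F)).

Section Center.

Variables (l n N : L).
Hypothesis (l_notpow : forall x : L, x ^+ (p ^ s).-1 != - l).

Local Notation sigma := (p ^ s)%N.
Local Notation mul := (B_mul sigma l n N).

Let root_l (x : L) : x ^+ sigma + l * x = 0 -> x = 0.
Proof.
move=> x0; apply/eqP/idPn => nz; case/negP: (l_notpow x).
have sE : sigma = (sigma.-1).+1 by rewrite prednK // lt0n sigma_eq0.
by rewrite -addr_eq0 -(mulIr_eq0 _ (mulIf nz)) mulrDl -exprSr -sE x0.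
Qed.

Let root_l' (x : L) : x + l * x ^+ sigma = 0 -> x = 0.
Proof.
move=> x0; apply/eqP/idPn => nz; case/negP: (l_notpow x^-1).
have sE : sigma = (sigma.-1).+1 by rewrite prednK // lt0n sigma_eq0.
have nzs : x ^+ sigma != 0 by rewrite expf_neq0.
rewrite -addr_eq0 -(mulIr_eq0 _ (mulIf nzs)) mulrDl sE exprS mulrCA.
by rewrite exprVn mulVf ?expf_neq0 // mulr1 -exprS -sE x0.
Qed.

Lemma B_mul_e1 (c d : L) :
  mul (1, 0) (c, d) = (c ^+ sigma + l * c + n * N * (d ^+ sigma) + n * l * d, d).
Proof.
rewrite /B_mul expr1n expr0n sigma_eq0 /=; congr pair; ring.
Qed.

Lemma B_mul_e2 (a b : L) :
  mul (a, b) (1, 0) = (a + l * a ^+ sigma - n * b - n * l * N * b ^+ sigma, b).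
Proof.
rewrite /B_mul expr1n expr0n sigma_eq0 /=; congr pair; ring.
Qed.

Lemma B_mul_e_inj : injective (mul (1, 0)).
Proof.
move=> [c1 d1] [c2 d2]; rewrite !B_mul_e1 => -[+ eqd]; rewrite eqd.
move=> /addIr /addIr eqc; congr pair.
apply/eqP; rewrite -subr_eq0; apply/eqP/root_l.
by rewrite exprDp exprNp mulrBr addrACA -opprD eqc subrr.
Qed.

Lemma B_mul_inj_e : injective (mul^~ (1, 0)).
Proof.
move=> [a1 b1] [a2 b2].
rewrite -[LHS]/(mul _ _) -[RHS]/(mul _ _) !B_mul_e2 => -[+ eqb]; rewrite eqb.
move=> /addIr /addIr eqa; congr pair.
apply/eqP; rewrite -subr_eq0; apply/eqP/root_l'.
by rewrite exprDp exprNp mulrBr addrACA -opprD eqa subrr.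
Qed.

Lemma B_mulZl (k : fixed_field) (x y : F) : mul (k *: x) y = k *: (mul x y : F).
Proof.
case: k x y => k Hk [a b] [c d]; have /eqP kE : k ^+ sigma == k by exact: Hk.
rewrite /B_mul /GRing.scale /= /L2_scale /= !exprMn kE.
by congr pair; ring.
Qed.

Lemma B_mulZr (k : fixed_field) (x y : F) : mul x (k *: y) = k *: (mul x y : F).
Proof.
case: k x y => k Hk [a b] [c d]; have /eqP kE : k ^+ sigma == k by exact: Hk.
rewrite /B_mul /GRing.scale /= /L2_scale /= !exprMn kE.
by congr pair; ring.
Qed.

Local Notation smul := (B_smul sigma l n N).

Let scale_e (k : fixed_field) : (fixed_val k, 0) = k *: ((1, 0) : F).
Proof. by rewrite /GRing.scale /= /L2_scale /= mulr1 mulr0. Qed.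

Lemma B_smulZl (k : fixed_field) (x : F) :
  smul (fixed_val k, 0) x = k *: x.
Proof.
rewrite scale_e /B_smul /assoc_mul; apply: B_mul_e_inj.
rewrite (assoc_betaP B_mul_e_inj) B_mulZr -B_mulZl; congr (mul _ x).
by apply: B_mul_inj_e; rewrite (assoc_gammaP B_mul_inj_e) B_mulZl B_mulZr.
Qed.

Lemma B_smulZr (k : fixed_field) (x : F) :
  smul x (fixed_val k, 0) = k *: x.
Proof.
rewrite scale_e /B_smul /assoc_mul; apply: B_mul_e_inj.
rewrite (assoc_betaP B_mul_e_inj) !B_mulZr.
by rewrite (assoc_gammaP B_mul_inj_e).
Qed.

End Center.

End FixedField.

(* Main.v *)
From HB Require Import structures.
Require Import Defs.
From mathcomp Require Import all_boot all_order all_algebra all_field.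
From mathcomp Require Import ring.
Set Implicit Arguments.
Unset Strict Implicit.
Unset Printing Implicit Defensive.
Import GRing.Theory.
Local Open Scope ring_scope.

(** The middle nucleus is identified with a finite ring of 2 x 2 matrices over
L, and Wedderburn's little theorem shows that this ring is K_1 or a quadratic
extension of K_1; so the dimension is in fact at most 2.

An element u lies in the middle nucleus exactly when the left multiplication f
by u is such that for every x there is a z with x * f y = z * y for all y
([middle_nucleusP]). The second coordinate a d + b c of the product forces f to
be L-linear, given by a matrix A, and determines z from x and A. For the first
coordinate, write phi for the map applying the power sigma to each entry, J for
the exchange of the coordinates, and
  h (x, y) = x^T Q phi(y) + l phi(x)^T S y.
The coefficients of phi(y) and of y give respectively
  J Q phi(A) = A J Q   and   phi(A) J S = J S A,
and these two conditions are equivalent since J Q J S is the nonzero scalar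
n N (n - 1). Hence the nucleus is the ring of the A with phi(A) P = P A, where
P = J S ([B_mul_regularP]); u is the first column of A.

A nonzero singular matrix A of this ring has a left kernel spanned by a single
row v, and phi(v) P lies in that kernel as well, so P maps phi(v) back to the
line of v. Written in the coordinate z = v_1 / (n v_0) - 1, and using
n^sigma = n N^2, this says that z is a root of the polynomial that has none by
hypothesis ([twisted_B_mx_singular]). So the ring is a finite domain, hence
commutative. If it contains a nonscalar A, each of its elements commutes with A
and so is x + y A with x and y in L; conjugation by P shows that x and y are
fixed by phi, i.e. are in K_1 ([twisted_quadratic]). *)

(** * Matrices commuting with a semilinear map *)

Section TwistedCentralizer.

Variables (F : finFieldType) (phi : {rmorphism F -> F}) (n : nat).
Variable P : 'M[F]_n.+1.

(** The matrices commuting with the phi-semilinear map v |-> phi(v) P on rows. *)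
Definition twisted : {pred 'M[F]_n.+1} :=
  fun A => map_mx phi A *m P == P *m A.

Lemma twistedP A : reflect (map_mx phi A *m P = P *m A) (A \in twisted).
Proof. exact: eqP. Qed.

Fact twisted_divring_closed : divring_closed twisted.
Proof.
split=> [|A B /twistedP tA /twistedP tB|A B /twistedP tA /twistedP tB].
- by apply/twistedP; rewrite rmorph1 mulmx1 mul1mx.
- by apply/twistedP; rewrite raddfB mulmxBl mulmxBr tA tB.
have tBV : map_mx phi B^-1 *m P = P *m B^-1.
  have [uB|nuB] := boolP (B \is a GRing.unit); last by rewrite invr_out.
  rewrite rmorphV //= -[P in LHS](mulrK uB) -[P * B]tB -!mulmxE.
  by rewrite !mulmxA mulmxE mulVr ?rmorph_unit // mul1r.
by apply/twistedP; rewrite rmorphM /= -mulmxE -mulmxA tBV mulmxA tA mulmxA.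
Qed.

HB.instance Definition _ :=
  GRing.isDivringClosed.Build 'M[F]_n.+1 twisted twisted_divring_closed.

Record twisted_ring : predArgType :=
  TwistedRing { twisted_val :> 'M[F]_n.+1; _ : twisted_val \in twisted }.

HB.instance Definition _ := [isSub for twisted_val].
HB.instance Definition _ := [Finite of twisted_ring by <:].
HB.instance Definition _ := [SubChoice_isSubUnitRing of twisted_ring by <:].

Hypothesis singular_eq0 : forall A, A \in twisted -> \det A = 0 -> A = 0.

(** Under the hypothesis on singular matrices the ring is a finite domain, and
Wedderburn's little theorem applies. *)
Lemma twisted_commute A B : A \in twisted -> B \in twisted -> A *m B = B *m A.
Proof.
have domR : GRing.integral_domain_axiom twisted_ring.
  move=> C D CD0.
  have {CD0} : val C *m val D = 0 by rewrite mulmxE -rmorphM CD0.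
  move=> CD; apply/orP; have [uC|nuC] := boolP (val C \in unitmx).
    by right; apply/eqP/val_inj; rewrite -[LHS](mulKmx uC) CD mulmx0.
  left; apply/eqP/val_inj/singular_eq0; first exact: valP.
  by apply/eqP; move: nuC; rewrite unitmxE unitfE negbK.
move=> tA tB.
have AB := finDomain_mulrC domR (TwistedRing tA) (TwistedRing tB).
exact: (congr1 \val AB).
Qed.

End TwistedCentralizer.

(** * Two by two matrices *)

Section Mx2.

Variable F : fieldType.
Implicit Types A B : 'M[F]_2.

Definition mx2 (a b c d : F) : 'M[F]_2 :=
  \matrix_(i, j) if i == 0 then if j == 0 then a else b
                 else if j == 0 then c else d.

Lemma ord2_ind (Q : 'I_2 -> Prop) : Q 0 -> Q 1 -> forall i, Q i.
Proof.
move=> Q0 Q1 i; have /orP[/eqP->|/eqP->] // : (i == 0) || (i == 1).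
by case: i => [[|[|]]].
Qed.

Lemma mx2P A B : A 0 0 = B 0 0 -> A 0 1 = B 0 1 -> A 1 0 = B 1 0 ->
  A 1 1 = B 1 1 -> A = B.
Proof. by move=> *; apply/matrixP; elim/ord2_ind; elim/ord2_ind. Qed.

Lemma mulmx2E m k (A : 'M[F]_(m, 2)) (B : 'M_(2, k)) i j :
  (A *m B) i j = A i 0 * B 0 j + A i 1 * B 1 j.
Proof.
rewrite mxE !big_ord_recl big_ord0 addr0.
by have -> : lift 0 0 = 1 :> 'I_2 by apply: val_inj.
Qed.

(** Nonscalar matrices of size 2 are cyclic, so that the centralizer is spanned
by the powers of A. *)
Lemma mx2_commute A B : ~~ is_scalar_mx A -> A *m B = B *m A ->
  exists x y, B = x%:M + y *: A.
Proof.
move=> nsA AB.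
have E00 : A 0 0 * B 0 0 + A 0 1 * B 1 0 = B 0 0 * A 0 0 + B 0 1 * A 1 0.
  by rewrite -!mulmx2E AB.
have E01 : A 0 0 * B 0 1 + A 0 1 * B 1 1 = B 0 0 * A 0 1 + B 0 1 * A 1 1.
  by rewrite -!mulmx2E AB.
have E10 : A 1 0 * B 0 0 + A 1 1 * B 1 0 = B 1 0 * A 0 0 + B 1 1 * A 1 0.
  by rewrite -!mulmx2E AB.
have [A01|A01] := eqVneq (A 0 1) 0; last first.
  (* The entry of B at a nonzero off-diagonal entry of A determines y. *)
  pose y := B 0 1 / A 0 1; exists (B 0 0 - y * A 0 0), y.
  apply: mx2P; rewrite !mxE /= ?mulr0n ?mulr1n ?add0r ?subrK //.
  - by rewrite /y divfK.
  - apply: (mulfI A01); rewrite /y mulrA mulrCA mulfV // mulr1.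
    by apply: (addrI (A 0 0 * B 0 0)); rewrite E00 mulrC.
  apply: (mulfI A01); apply: (addrI (A 0 0 * B 0 1)); rewrite E01 /y.
  by field.
have [A10|A10] := eqVneq (A 1 0) 0; last first.
  pose y := B 1 0 / A 1 0; exists (B 0 0 - y * A 0 0), y.
  apply: mx2P; rewrite !mxE /= ?mulr0n ?mulr1n ?add0r ?subrK //.
  - apply: (mulIf A10); rewrite A01 !mulr0 mul0r.
    by apply: (addrI (B 0 0 * A 0 0)); rewrite -E00 A01; ring.
  - by rewrite /y divfK.
  apply: (mulIf A10); apply: (addrI (B 1 0 * A 0 0)); rewrite -E10 /y.
  by field.
(* A is now diagonal with distinct diagonal entries, and so is B. *)
have dA : A 1 1 - A 0 0 != 0.
  apply: contraNneq nsA => /eqP; rewrite subr_eq0 => /eqP dA.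
  apply/is_scalar_mxP; exists (A 0 0).
  by apply: mx2P; rewrite !mxE.
pose y := (B 1 1 - B 0 0) / (A 1 1 - A 0 0); exists (B 0 0 - y * A 0 0), y.
apply: mx2P; rewrite !mxE /= ?mulr0n ?mulr1n ?add0r ?subrK //.
- apply: (mulfI dA); rewrite A01 !mulr0; apply/eqP.
  move/eqP: E01; rewrite A01 mul0r mulr0 addr0 add0r -subr_eq0 -oppr_eq0.
  by move/eqP <-; apply/eqP; ring.
- apply: (mulfI dA); rewrite A10 !mulr0; apply/eqP.
  move/eqP: E10; rewrite A10 mul0r mulr0 addr0 add0r -subr_eq0.
  by move/eqP <-; apply/eqP; ring.
by rewrite /y; field.
Qed.

(** The left kernel of a nonzero A is at most a line, so v and w are
proportional. *)
Lemma mx2_left_kernel A (v w : 'rV_2) : A != 0 -> v *m A = 0 -> w *m A = 0 ->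
  v 0 0 * w 0 1 - v 0 1 * w 0 0 = 0.
Proof.
move=> nzA vA wA; apply/eqP; apply: contraNT nzA => nz; apply/eqP.
have row0 j : A 0 j = 0 /\ A 1 j = 0.
  have: (v *m A) 0 j = 0 by rewrite vA mxE.
  have: (w *m A) 0 j = 0 by rewrite wA mxE.
  rewrite !mulmx2E => w0 v0; split; apply: (mulfI nz); rewrite mulr0.
    transitivity (w 0 1 * (v 0 0 * A 0 j + v 0 1 * A 1 j)
       - v 0 1 * (w 0 0 * A 0 j + w 0 1 * A 1 j)); first by ring.
    by rewrite w0 v0 !mulr0 subrr.
  transitivity (v 0 0 * (w 0 0 * A 0 j + w 0 1 * A 1 j)
     - w 0 0 * (v 0 0 * A 0 j + v 0 1 * A 1 j)); first by ring.
  by rewrite w0 v0 !mulr0 subrr.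
by apply: mx2P; rewrite [RHS]mxE; case: (row0 0); case: (row0 1).
Qed.

End Mx2.

(** * Twisted rings of size 2 *)

Section TwistedMx2.

Variables (F : finFieldType) (phi : {rmorphism F -> F}) (P : 'M[F]_2).
Local Notation T := (twisted phi P).

(** The left kernel of a matrix of the ring is stable under v |-> phi(v) P, so
that, being a line, it is a fixed point of this map on the projective line. *)
Lemma twisted_singular A : A \in T -> A != 0 -> \det A = 0 ->
  exists2 v : 'rV[F]_2, v != 0
    & let w := map_mx phi v *m P in v 0 0 * w 0 1 - v 0 1 * w 0 0 = 0.
Proof.
move=> /twistedP tA nzA /eqP/det0P [v nzv vA]; exists v => //=.
apply: (mx2_left_kernel nzA) => //.
by rewrite -mulmxA -tA mulmxA -map_mxM vA map_mx0 mul0mx.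
Qed.

(** The coefficients of B on 1 and on a nonscalar A are unique, and applying phi
and then conjugating by P turns them into their images under phi; hence phi
fixes them. When the ring has only scalars, A = 0 serves. *)
Lemma twisted_quadratic : P \in unitmx ->
    (forall A, A \in T -> \det A = 0 -> A = 0) ->
  exists2 A, A \in T & forall B, B \in T ->
    exists x y, [/\ phi x = x, phi y = y & B = x%:M + y *: A].
Proof.
move=> uP sing0.
have conj_phi A B x y : A \in T -> B \in T -> B = x%:M + y *: A ->
    B = (phi x)%:M + phi y *: A.
  move=> /twistedP tA /twistedP tB eB; rewrite -[LHS](mulKmx uP) -tB.
  rewrite eB map_mxD map_scalar_mx map_mxZ mulmxDl -scalar_mxC -scalemxAl tA.
  by rewrite scalemxAr -mulmxDr mulKmx.
have [/existsP[A /andP[tA nsA]]|/existsPn all_scalar] :=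
    boolP [exists A, (A \in T) && ~~ is_scalar_mx A].
  exists A => // B tB.
  have [x [y eB]] := mx2_commute nsA (twisted_commute sing0 tA tB).
  have := conj_phi _ _ _ _ tA tB eB; rewrite {1}eB => eBphi.
  have ey : phi y = y.
    apply/eqP; rewrite -subr_eq0; apply: contraNT nsA => nz.
    apply/is_scalar_mxP; exists ((phi y - y)^-1 * (x - phi x)).
    apply: (scalerI nz); rewrite scale_scalar_mx mulVKf // scalerBl raddfB /=.
    by apply/eqP; rewrite subr_eq addrAC eBphi addrAC subrr add0r.
  move: eBphi; rewrite ey => /addIr/matrixP/(_ 0 0); rewrite !mxE !mulr1n => ex.
  by exists x, y.
exists 0; first exact: rpred0.
move=> B tB; have := all_scalar B; rewrite tB negbK => /is_scalar_mxP[x eB].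
have := conj_phi 0 B x 0 (rpred0 _) tB; rewrite scaler0 addr0 => /(_ eB).
rewrite eB scaler0 addr0 => /matrixP/(_ 0 0); rewrite !mxE !mulr1n => ex.
by exists x, 0; rewrite rmorph0 scale0r addr0.
Qed.

End TwistedMx2.

(** * The map x |-> x ^ sigma as a ring morphism *)

Section SigmaMorphism.

Variables (L : finFieldType) (p : nat).

(** The proof that p is the characteristic is an argument because additivity
depends on it. *)
Definition sigma_hom of p \in [pchar L] :=
  fun (s : nat) (x : L) => x ^+ (p ^ s).

Variables (chLp : p \in [pchar L]) (s : nat).
Local Notation phi := (sigma_hom chLp s).

Fact sigma_hom_is_zmod_morphism : zmod_morphism phi.
Proof. by move=> x y; rewrite /sigma_hom (exprDp chLp) (exprNp chLp). Qed.

Fact sigma_hom_is_monoid_morphism : monoid_morphism phi.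
Proof. by split=> [|x y]; rewrite /sigma_hom ?expr1n ?exprMn. Qed.

HB.instance Definition _ :=
  GRing.isZmodMorphism.Build L L phi sigma_hom_is_zmod_morphism.
HB.instance Definition _ :=
  GRing.isMonoidMorphism.Build L L phi sigma_hom_is_monoid_morphism.

End SigmaMorphism.

(** * The middle nucleus in terms of the presemifield *)

Section MiddleNucleus.

Variables (F : finType) (mul : F -> F -> F) (e : F).
Hypotheses (inj_l : injective (mul e)) (inj_r : injective (mul^~ e)).
Local Notation beta := (assoc_beta mul e).
Local Notation gamma := (assoc_gamma mul e).

(** The left multiplications of the associated semifield are those of [mul]
followed by the inverse of the one by [e], reindexed by the bijection gamma.
So u is in the middle nucleus when composing with f on the right, f being the
left multiplication by u, preserves the set of left multiplications of [mul].
The function f is then recovered from z for x = e, and u as f e. *)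
Lemma middle_nucleusP u :
  u \in middle_nucleus (assoc_mul mul e) <->
  exists f : F -> F, f e = u /\
    forall x, exists z, forall y, mul x (f y) = mul z y.
Proof.
have betaK := assoc_betaP inj_l; have gammaK := assoc_gammaP inj_r.
have beta_inj : injective beta by apply: can_inj betaK.
have gamma_inj : injective gamma.
  by move=> x y /(congr1 (mul^~ e)); rewrite !gammaK => /inj_l.
rewrite inE; split=> [/forallP nuc|[f [<- fP]]].
  exists (assoc_mul mul e u); split=> [|x].
    by apply: inj_l; rewrite betaK gammaK.
  exists (gamma (assoc_mul mul e (invF gamma_inj x) u)) => y.
  have /forallP/(_ y)/eqP/beta_inj := nuc (invF gamma_inj x).
  by rewrite f_invF => <-.
apply/forallP=> x; apply/forallP=> y; apply/eqP.
have [z zP] := fP e; have [w wP] := fP (gamma x).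
have gfe : gamma (f e) = z by apply: inj_r; rewrite gammaK zP.
have gx : gamma (assoc_mul mul e x (f e)) = w.
  by apply: inj_r; rewrite gammaK betaK wP.
rewrite {1}/assoc_mul gx -wP; congr beta; congr mul.
by apply: inj_l; rewrite /assoc_mul gfe betaK.
Qed.

End MiddleNucleus.

(** * The middle nucleus as a twisted ring *)

Section BMultiplication.

Variables (L : finFieldType) (p : nat) (chLp : p \in [pchar L]) (s : nat).
Variables (l n N : L).
Local Notation sigma := (p ^ s)%N.
Local Notation phi := (sigma_hom chLp s).
Local Notation mul := (B_mul sigma l n N).

Hypotheses (l_neq0 : l != 0) (n_neq0 : n != 0) (N_neq0 : N != 0).
Hypothesis (n_neq1 : n - 1 != 0).

(** The matrix P = J S, where l phi(x)^T S y is the part of the first coordinate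
of x * y that is linear in y, and J exchanges the coordinates. *)
Definition B_mx : 'M[L]_2 := mx2 (- (n * N)) (- (n * N)) 1 n.
Local Notation T := (twisted phi B_mx).

Definition mx2_act (A : 'M[L]_2) (y : L * L) : L * L :=
  (A 0 0 * y.1 + A 0 1 * y.2, A 1 0 * y.1 + A 1 1 * y.2).

Lemma B_mx_unit : B_mx \in unitmx.
Proof.
(* Up to the scalar, Q is J times the matrix of the part semilinear in y. *)
pose Q := (n * N * (n - 1))^-1 *: mx2 (- n) (- (n * N)) 1 (n * N).
have [] // := @mulmx1_unit _ _ B_mx Q.
apply: mx2P; rewrite mulmx2E !mxE /= ?mulr1n ?mulr0n; field;
  by apply/and3P; split.
Qed.

(** The equation phi(A) P = P A is solved for the powers, so that these can be
eliminated from any identity in the entries of A. *)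
Lemma twisted_B_mxE A : A \in T ->
  [/\ A 1 0 ^+ sigma = (A 0 0 + n * A 1 0 - n^-1 * A 0 1 - A 1 1)
                         / (N * (1 - n)),
      A 0 0 ^+ sigma = (n * A 0 0 + n * A 1 0 - A 0 1 - A 1 1) / (n - 1),
      A 0 1 ^+ sigma = n * N * (A 0 0 + A 1 0 - A 0 1 - A 1 1) / (n - 1)
    & A 1 1 ^+ sigma = (n * A 1 1 - n * A 1 0 + A 0 1 - A 0 0) / (n - 1)].
Proof.
have n1 : 1 - n != 0 by rewrite -opprB oppr_eq0.
move=> /twistedP eT.
have E i j : (map_mx phi A *m B_mx) i j = (B_mx *m A) i j by rewrite eT.
have := E 0 0; have := E 0 1; have := E 1 0; have := E 1 1.
rewrite !mulmx2E !mxE /= /sigma_hom.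
move: (A 0 0) (A 0 1) (A 1 0) (A 1 1) => t u v w.
move: (t ^+ _) (u ^+ _) (v ^+ _) (w ^+ _) => t' u' v' w'.
move=> e11 e10 e01 e00; split.
- apply: (mulfI (mulf_neq0 (mulf_neq0 n_neq0 N_neq0) n1)).
  transitivity (n * (v' * - (n * N) + w' * 1) - (v' * - (n * N) + w' * n)).
    by ring.
  by rewrite e10 e11; field; apply/and3P; split.
- apply: (mulfI (mulf_neq0 (mulf_neq0 n_neq0 N_neq0) n_neq1)).
  transitivity ((t' * - (n * N) + u' * n) - n * (t' * - (n * N) + u' * 1)).
    by ring.
  by rewrite e00 e01; field.
- apply: (mulfI n_neq1).
  transitivity ((t' * - (n * N) + u' * n) - (t' * - (n * N) + u' * 1)).
    by ring.
  by rewrite e00 e01; field.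
apply: (mulfI n_neq1).
transitivity ((v' * - (n * N) + w' * n) - (v' * - (n * N) + w' * 1)).
  by ring.
by rewrite e10 e11; field.
Qed.

(** In terms of x = (a, b), the left factor on the right-hand side is J A^T J x,
the only one for which the second coordinates agree for all y. *)
Lemma B_mul_mx2_act A a b y : A \in T ->
  mul (a, b) (mx2_act A y) =
  mul (a * A 1 1 + b * A 0 1, a * A 1 0 + b * A 0 0) y.
Proof.
have n1 : 1 - n != 0 by rewrite -opprB oppr_eq0.
case: y => c d /twisted_B_mxE[e10 e00 e01 e11].
rewrite /mx2_act /B_mul !(exprDp chLp) !exprMn e00 e01 e10 e11 /=.
congr pair; last by ring.
by field; rewrite ?n1 ?n_neq0 ?N_neq0 ?n_neq1.
Qed.

Hypothesis sigma_neq1 : exists x : L, x ^+ sigma != x.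

(** Special case of the linear independence of field automorphisms. *)
Lemma sigma_independent (a b : L) :
  (forall x, a * x ^+ sigma + b * x = 0) -> b = 0.
Proof.
case: sigma_neq1 => x nx ab0; have /eqP := ab0 1.
rewrite expr1n !mulr1 addr_eq0 => /eqP ea; apply/eqP.
apply: contraNT nx => nzb; rewrite -subr_eq0 -(mulrI_eq0 _ (mulfI nzb)).
by rewrite -oppr_eq0 -[X in _ == X](ab0 x) ea; apply/eqP; ring.
Qed.

(** The parts of x * f y and z * y that are linear in y already force
phi(A) P = P A; the semilinear parts then agree by [B_mul_mx2_act]. *)
Lemma B_mul_regularP f :
  (forall x, exists z, forall y, mul x (f y) = mul z y) <->
  exists2 A, A \in T & f =1 mx2_act A.
Proof.
have s0 : 0 ^+ sigma = 0 :> L := rmorph0 phi.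
split=> [fP|[A tA fA] [a b]]; last first.
  by exists (a * A 1 1 + b * A 0 1, a * A 1 0 + b * A 0 0) => y;
     rewrite fA B_mul_mx2_act.
(* The second coordinates for x = (1, 0) and x = (0, 1) read off the rows of
   the matrix. *)
have [[w v] e1P] := fP (1, 0); have [[u t] e2P] := fP (0, 1).
have fE c d : f (c, d) = (t * c + u * d, v * c + w * d).
  have := e1P (c, d); have := e2P (c, d).
  rewrite /B_mul; case: (f _) => c' d' [_ e2] [_ e1]; move: e1 e2.
  by rewrite !mul0r !mul1r !addr0 !add0r => -> ->; congr pair; ring.
exists (mx2 t u v w) => [|[c d]]; last by rewrite fE /mx2_act !mxE.
have E1 c d := congr1 fst (e1P (c, d)); have E2 c d := congr1 fst (e2P (c, d)).
have eq c1 c2 : l * (c1 - c2) = 0 -> c1 = c2 :> L.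
  by move/eqP; rewrite mulf_eq0 (negPf l_neq0) subr_eq0 => /eqP.
(* Each entry of the equation is a coefficient of the first coordinate, for one
   x and one y among (c, 0), (0, d); the factor l is cancelled by eq. *)
apply/twistedP/mx2P; rewrite !mulmx2E !mxE /= /sigma_hom; apply: eq.
- apply: (@sigma_independent
    (n * t ^+ sigma + n * N * v ^+ sigma + u - n * t)) => c.
  have := E2 c 0; rewrite fE /B_mul /= !mulr0 !addr0 s0 expr1n !exprMn.
  move/esym/eqP; rewrite -subr_eq0 => /eqP e0; rewrite -[RHS]e0; ring.
- apply: (@sigma_independent
    (n * N * w ^+ sigma + n * u ^+ sigma - n * N * t + n * N * u)) => d.
  have := E2 0 d; rewrite fE /B_mul /= !mulr0 !add0r s0 expr1n !exprMn.
  move/esym/eqP; rewrite -subr_eq0 => /eqP e0; rewrite -[RHS]e0; ring.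
- apply: (@sigma_independent
    (- (t ^+ sigma + n * N * v ^+ sigma - w + n * v))) => c.
  have := E1 c 0; rewrite fE /B_mul /= !mulr0 !addr0 s0 expr1n !exprMn.
  move/esym/eqP; rewrite -subr_eq0 => /eqP e0; rewrite -[RHS]e0; ring.
apply: (@sigma_independent
  (- (u ^+ sigma + n * N * w ^+ sigma + n * N * v - n * N * w))) => d.
have := E1 0 d; rewrite fE /B_mul /= !mulr0 !add0r s0 expr1n !exprMn.
move/esym/eqP; rewrite -subr_eq0 => /eqP e0; rewrite -[RHS]e0; ring.
Qed.

End BMultiplication.

(** * The twisted ring has no zero divisors *)

Section NonDegenerate.

Variables (L : finFieldType) (p : nat) (chLp : p \in [pchar L]) (s : nat).
Variables (n N : L).
Local Notation sigma := (p ^ s)%N.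

Hypotheses (n_neq0 : n != 0) (N_neq0 : N != 0).
Hypothesis noroot : forall x : L,
  x ^+ (sigma + 1) + (1 - 1 / N) * x + (1 / n - 1) / N != 0.
Hypothesis n_eq : n ^+ (sigma - 1) = N ^+ 2.

(** For n = 1 the polynomial would have the root 0. *)
Lemma noroot_n_neq1 : n - 1 != 0.
Proof.
apply: contraNneq (noroot 0) => /eqP; rewrite subr_eq0 => /eqP ->.
by rewrite addn1 expr0n /= mulr0 divr1 subrr mul0r !addr0.
Qed.

(** A line of rows (x, y) fixed by v |-> phi(v) P has x nonzero, and the
substitution z = y / (n x) - 1 turns the equation of the fixed lines into the
polynomial in z that is assumed to have no root. *)
Lemma twisted_B_mx_singular A :
  A \in twisted (sigma_hom chLp s) (B_mx n N) -> \det A = 0 -> A = 0.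
Proof.
move=> tA detA; apply/eqP; apply: contraT => nzA.
have [v nzv] := twisted_singular tA nzA detA.
rewrite /= !mulmx2E !mxE /= /sigma_hom.
set x := v 0 0; set y := v 0 1 => eq0.
have nzx : x != 0.
  apply: contraNneq nzv => x0.
  have s0 : 0 ^+ sigma = 0 :> L := rmorph0 (sigma_hom chLp s).
  move: eq0; rewrite x0 s0 !mul0r !add0r mulr1 => /eqP.
  rewrite oppr_eq0 mulf_eq0 expf_eq0 => y0.
  have {}y0 : y = 0 by case/orP: y0 => [|/andP[_]] /eqP.
  by apply/eqP/rowP; elim/ord2_ind; rewrite mxE.
have ns : n ^+ sigma = n * N ^+ 2.
  rewrite -n_eq -exprS subn1 prednK //.
  by rewrite expn_gt0 prime_gt0 ?(pcharf_prime chLp).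
case/eqP: (noroot (y / x / n - 1)).
rewrite addn1 exprS (exprDp chLp) (exprNp chLp) expr1n !exprMn !exprVn ns.
have nzxs : x ^+ sigma != 0 by rewrite expf_neq0.
move: eq0 nzxs; move: (x ^+ sigma) (y ^+ sigma) => x' y' eq0 nzx'.
transitivity (- (x * (x' * - (n * N) + y' * n) - y * (x' * - (n * N) + y' * 1))
   / (n ^+ 2 * N ^+ 2 * x * x')); last by rewrite eq0 oppr0 mul0r.
by field; rewrite n_neq0 N_neq0 nzx nzx'.
Qed.

End NonDegenerate.

Theorem proposition8p29 (p m s : nat) (L : finFieldType) (l n N : L)
    (p_prime : prime p) (p_odd : odd p) (cardL : #|L| = (p ^ m)%N)
    (s_gt0 : (0 < s)%N) (s_lt_m : (s < m)%N)
    (sigma := (p ^ s)%N)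
    (F := L2 (card_finPcharP cardL p_prime) s)
    (l_neq0 : l != 0) (n_neq0 : n != 0) (N_neq0 : N != 0)
    (l_notpow : forall x : L, x ^+ (sigma - 1) != - l)
    (noroot : forall x : L,
       x ^+ (sigma + 1) + (1 - 1 / N) * x + (1 / n - 1) / N != 0)
    (n_eq : n ^+ (sigma - 1) = N ^+ 2)
    (sigma2 : exists x : L, x ^+ (sigma ^ 2) != x) :
  exists Nm : {vspace F},
    (forall u : F, (u \in Nm) = (u \in middle_nucleus (B_smul sigma l n N)))
    /\ (1 <= \dim Nm <= 3)%N.
Proof.
set chLp := card_finPcharP cardL p_prime in F *.
pose T := twisted (sigma_hom chLp s) (B_mx n N).
have n_neq1 := noroot_n_neq1 noroot.
(* If sigma were the identity on L, so would be its square. *)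
have sigma_neq1 : exists x : L, x ^+ sigma != x.
  have [x nx] := sigma2; exists x; apply: contraNneq nx => xs.
  by rewrite -mulnn exprM !xs.
have l_notpow' (x : L) : x ^+ sigma.-1 != - l by rewrite -subn1.
have nucleusP (u : F) : reflect (exists2 A, A \in T & u = (A 0 0, A 1 0))
    (u \in middle_nucleus (B_smul sigma l n N)).
  have actE (A : 'M[L]_2) : mx2_act A (1, 0) = (A 0 0, A 1 0).
    by rewrite /mx2_act /= !mulr1 !mulr0 !addr0.
  have nucP := @middle_nucleusP _ (B_mul sigma l n N) (1, 0)
    (B_mul_e_inj chLp l_notpow') (B_mul_inj_e chLp l_notpow') u.
  have regP := B_mul_regularP chLp l_neq0 n_neq0 N_neq0 n_neq1 sigma_neq1.
  apply: (iffP idP) => [/nucP[f [<- /regP[A tA fA]]]|[A tA uE]].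
    by exists A; rewrite // fA actE.
  by apply/nucP; exists (mx2_act A); split; [rewrite actE|apply/regP; exists A].
have [A tA genT] := twisted_quadratic (B_mx_unit n_neq0 N_neq0 n_neq1)
  (twisted_B_mx_singular n_neq0 N_neq0 noroot n_eq).
pose e : F := (1, 0); pose a : F := (A 0 0, A 1 0).
(* e and a are the elements of the nucleus given by the matrices 1 and A. *)
exists (<[e]> + <[a]>)%VS; split=> [u|]; last first.
  apply/andP; split.
    have nz_e : e != 0 by apply: contra_neq (oner_neq0 L) => -[].
    by apply: leq_trans (dimvS (addvSl <[e]> <[a]>)); rewrite dim_vline nz_e.
  apply: leq_trans (dimv_add_leqif _ _) _; rewrite !dim_vline.
  by do 2 case: (_ != 0).
apply/idP/nucleusP=>
  [/memv_addP[_ /vlineP[k ->] [_ /vlineP[k' ->] ->]]|[B tB ->]].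
  exists ((fixed_val k)%:M + fixed_val k' *: A).
    have fix_phi (c : fixed_field chLp s) :
        sigma_hom chLp s (fixed_val c) = fixed_val c.
      by case: c => c cP; apply/eqP.
    move/twistedP: tA => tA; apply/twistedP.
    rewrite map_mxD map_scalar_mx map_mxZ /= !fix_phi mulmxDl mulmxDr.
    by rewrite scalar_mxC -scalemxAl tA scalemxAr.
  by rewrite !mxE /=; congr pair => /=; rewrite ?mulr1 ?mulr0 ?mulr1n ?mulr0n.
have [x [y [phx phy ->]]] := genT B tB.
have fx : x \in fixed_pred s chLp by apply/eqP.
have fy : y \in fixed_pred s chLp by apply/eqP.
apply/memv_addP; exists (FixedField fx *: e).
  by apply/vlineP; exists (FixedField fx).
exists (FixedField fy *: a); first by apply/vlineP; exists (FixedField fy).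
by rewrite !mxE /=; congr pair => /=; rewrite ?mulr1 ?mulr0 ?mulr1n ?mulr0n.
Qed.
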